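(* Let $\mathcal{D}$ be a probability distribution on $\mathcal{X}\times\{-1,1\}$, let $\mathcal{F}$ be a class of functions $f:\mathcal{X}\to\mathbb{R}$, let $x\mapsto\eta_x\in[0,1]$ be a noise rate function on $\mathcal{X}$, and consider the exponential loss $\mathcal{L}(s,y)=-y e^{s}$ for $s\in\mathbb{R}$, $y\in\{-1,1\}$. Let $R_{\mathcal{L}}(f)$ be the clean risk and $R^{\eta}_{\mathcal{L}}(f)$ the noisy risk. Let $f_\eta^\ast\in\mathcal{F}$ be a minimizer of the noisy risk, $f_\eta^\ast=\operatorname{arg\,inf}_{f\in\mathcal{F}}R^{\eta}_{\mathcal{L}}(f)$, and let $\epsilon=\inf_{f\in\mathcal{F}}R_{\mathcal{L}}(f)$ be the optimal clean risk. If $\eta_x\le\eta_{\max}<0.5$ for all $x\in\mathcal{X}$, and if the prediction score is bounded by $s_{\max}$ (that is, $|f(x)|\le s_{\max}$ for all $f\in\mathcal{F}$ and $x\in\mathcal{X}$), then $$R_{\mathcal{L}}(f_\eta^\ast)\le\frac{\epsilon+2\,\eta_{\max}\,e^{s_{\max}}}{1-2\eta_{\max}}.$$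
   Context: Binary classification with noisy labels: clean samples $(x,y)$ are drawn from $\mathcal{D}$ on $\mathcal{X}\times\{-1,1\}$. The noisy distribution $\mathcal{D}_\eta$ is the law of $(x,\hat y)$, where, given $(x,y)\sim\mathcal{D}$, $\hat y=y$ with probability $1-\eta_x$ and $\hat y=-y$ with probability $\eta_x$ (the noise rate depends on the data point $x$). For a loss $\ell:\mathbb{R}\times\{-1,1\}\to\mathbb{R}$ and $f\in\mathcal{F}$, the clean risk is $R_\ell(f)=\mathbb{E}_{(x,y)\sim\mathcal{D}}[\ell(f(x),y)]$ and the noisy risk is $R_\ell^\eta(f)=\mathbb{E}_{(x,\hat y)\sim\mathcal{D}_\eta}[\ell(f(x),\hat y)]$. The function $\eta$ and all $f\in\mathcal{F}$ are assumed measurable. *)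

(* Defs.v *)
From HB Require Import structures.
From mathcomp Require Import all_boot all_order all_algebra.
From mathcomp Require Import all_classical all_reals all_analysis measurable_realfun.

Set Implicit Arguments.
Unset Strict Implicit.
Unset Printing Implicit Defensive.

Import Order.TTheory GRing.Theory Num.Theory.
Import numFieldNormedType.Exports.

Local Open Scope classical_set_scope.
Local Open Scope ring_scope.

(* The label set {-1, 1} is encoded by [bool] with its discrete sigma-algebra:
   [true] stands for 1, [false] for -1, and [~~ y] for -y. *)
Definition label (R : realType) (y : bool) : R := if y then 1 else -1.

Definition exp_loss (R : realType) (s : R) (y : bool) : R :=
  - label R y * expR s.

Definition flip_label (X : Type) (z : X * bool) : X * bool := (z.1, ~~ z.2).

Section noisy_distr.
Context d (X : measurableType d) (R : realType).
Variables (D : probability (X * bool)%type R) (eta : X -> R).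
Local Open Scope ereal_scope.

(* Law of (x, yhat) given (x, y) = z. *)
Definition noise_step (z : X * bool) (A : set (X * bool)) : \bar R :=
  (1 - eta z.1)%:E * \d_z A + (eta z.1)%:E * \d_(flip_label z) A.

(* The hypotheses on [eta] are arguments: without them the mixture below need
   not be a probability measure. *)
Definition noisy_distr (meta : measurable_fun [set: X] eta)
    (eta01 : forall x, (0 <= eta x <= 1)%R) (A : set (X * bool)) : \bar R :=
  \int[D]_z noise_step z A.

Hypothesis meta : measurable_fun [set: X] eta.
Hypothesis eta01 : forall x, (0 <= eta x <= 1)%R.

Let eta_ge0 x : (0 <= eta x)%R. Proof. by case/andP: (eta01 x). Qed.

Let eta_le1 x : (0 <= 1 - eta x)%R.
Proof. by rewrite subr_ge0; case/andP: (eta01 x). Qed.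

Let noise_step_ge0 z A : 0 <= noise_step z A.
Proof. by rewrite adde_ge0// mule_ge0// lee_fin. Qed.

Let noise_stepE z : noise_step z =
  measure_add (mscale (NngNum (eta_le1 z.1)) \d_z)
              (mscale (NngNum (eta_ge0 z.1)) \d_(flip_label z)).
Proof. by apply/funext => A; rewrite measure_addE. Qed.

Let measurable_flip : measurable_fun [set: X * bool] (@flip_label X).
Proof.
apply: measurable_fun_pair; first exact: measurable_fst.
exact: (measurableT_comp (f := negb)).
Qed.

Let measurable_noise_step (A : set (X * bool)) : measurable A ->
  measurable_fun [set: X * bool] (noise_step ^~ A : X * bool -> \bar R).
Proof.
move=> mA; have me : measurable_fun setT (fun z : X * bool => eta z.1).
  exact: measurableT_comp meta measurable_fst.
apply: emeasurable_funD; apply: emeasurable_funM.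
- by apply/measurable_EFinP; exact: measurable_funB.
- exact: measurable_fun_dirac.
- exact/measurable_EFinP.
- exact: (measurableT_comp (measurable_fun_dirac mA) measurable_flip).
Qed.

Let noisy_distr0 : noisy_distr meta eta01 set0 = 0.
Proof.
by apply: integral0_eq => z _; rewrite /noise_step !measure0 !mule0 adde0.
Qed.

Let noisy_distr_ge0 A : 0 <= noisy_distr meta eta01 A.
Proof. exact: integral_ge0. Qed.

Let noisy_distr_sigma_additive : semi_sigma_additive (noisy_distr meta eta01).
Proof.
move=> U mU tU mUU; rewrite [X in _ --> X](_ : _ =
  \int[D]_z (\sum_(n <oo) noise_step z (U n))); last first.
  apply: eq_integral => z _; rewrite noise_stepE.
  by apply/esym/cvg_lim => //; exact/measure_semi_sigma_additive.
apply/cvg_closeP; split.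
  by apply: is_cvg_nneseries => n _ _; exact: integral_ge0.
rewrite closeE// integral_nneseries// => n.
exact: measurable_noise_step.
Qed.

HB.instance Definition _ := isMeasure.Build _ _ _ (noisy_distr meta eta01)
  noisy_distr0 noisy_distr_ge0 noisy_distr_sigma_additive.

Let noisy_distr_setT : noisy_distr meta eta01 setT = 1.
Proof.
rewrite /noisy_distr (eq_integral (cst 1)) => [|z _].
  by rewrite integral_cst// mul1e; exact: (probability_setT D).
by rewrite /noise_step !diracT !mule1 -EFinD subrK.
Qed.

HB.instance Definition _ := Measure_isProbability.Build _ _ _
  (noisy_distr meta eta01) noisy_distr_setT.

End noisy_distr.

Section risk.
Context d (X : measurableType d) (R : realType).
Local Open Scope ereal_scope.

Definition risk (l : R -> bool -> R) (D : probability (X * bool)%type R)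
  (f : X -> R) : \bar R := 'E_D[fun z => l (f z.1) z.2].

Definition noisy_risk (l : R -> bool -> R) (D : probability (X * bool)%type R)
    (eta : X -> R) (meta : measurable_fun [set: X] eta)
    (eta01 : forall x, (0 <= eta x <= 1)%R) (f : X -> R) : \bar R :=
  risk l (noisy_distr D meta eta01) f.

End risk.

Definition is_minimizer (T : Type) (R : realType) (J : T -> \bar R)
    (F : set T) (f0 : T) : Prop :=
  F f0 /\ forall f, F f -> (J f0 <= J f)%E.

(* Main.v *)
(* The loss is odd in the label, so the noisy risk of f is the clean expectation
   of w * L(f), with weight w = 1 - 2 eta_x. Let m = 1 - 2 eta_max and
   B = exp s_max, so that |L| <= B and m <= w <= 1. For the noisy minimizer g
   and a competitor f,
     m E[L(g)] = E[w L(g)] - E[(w - m) L(g)]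
               <= E[w L(f)] - E[(w - m) L(g)]
                = E[L(f)] - E[(1 - w) L(f)] - E[(w - m) L(g)]
               <= E[L(f)] + (1 - m) B.
   Bounding E[L(g)] by E[L(f)] + 2 eta_max B first and dividing by m afterwards
   would fail, since the risk may be negative. *)
Require Import Defs.
From HB Require Import structures.
From mathcomp Require Import all_boot all_order all_algebra.
From mathcomp Require Import all_classical all_reals all_analysis measurable_realfun.
From mathcomp Require Import ring lra.

Import Order.TTheory GRing.Theory Num.Theory.
Import numFieldNormedType.Exports.

Local Open Scope classical_set_scope.
Local Open Scope ring_scope.

Lemma bounded_EFin_integrable d (T : measurableType d) (R : realType)
    (P : probability T R) (h : T -> R) (B : R) :
    measurable_fun [set: T] h -> (forall z, `|h z| <= B) ->
  P.-integrable [set: T] (EFin \o h).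
Proof.
move=> mh hB; apply: measurable_bounded_integrable => //.
  by apply: le_lt_trans (probability_le1 P measurableT) _; rewrite ltry.
exists B; split; first exact: num_real.
by move=> M BM z _ /=; rewrite (le_trans (hB z))// ltW.
Qed.

Section noisy_distr_integral.
Context d (X : measurableType d) (R : realType).
Variables (D : probability (X * bool)%type R) (eta : X -> R).
Hypothesis meta : measurable_fun [set: X] eta.
Hypothesis eta01 : forall x, 0 <= eta x <= 1.
Local Open Scope ereal_scope.

Lemma measurable_flip_label : measurable_fun [set: X * bool] (@flip_label X).
Proof.
apply: measurable_fun_pair; first exact: measurable_fst.
exact: (measurableT_comp (f := negb)).
Qed.

Let eta_ge0 x : (0 <= eta x)%R. Proof. by case/andP: (eta01 x). Qed.

Let eta_le1 x : (0 <= 1 - eta x)%R.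
Proof. by rewrite subr_ge0; case/andP: (eta01 x). Qed.

(* [integral_kcomp] composes with a kernel on a product, hence the dummy
   [unit] factor. *)
Definition noise_kernel (u : unit * (X * bool)) :
    {measure set (X * bool) -> \bar R} :=
  measure_add (mscale (NngNum (eta_le1 u.2.1)) \d_(u.2))
              (mscale (NngNum (eta_ge0 u.2.1)) \d_(flip_label u.2)).

Let noise_kernelE u A : noise_kernel u A = noise_step eta u.2 A.
Proof. exact: measure_addE. Qed.

Let measurable_noise_kernel A : measurable A ->
  measurable_fun [set: unit * (X * bool)] (noise_kernel ^~ A).
Proof.
move=> mA; under eq_fun do rewrite noise_kernelE.
have m2 : measurable_fun setT (fun u : unit * (X * bool) => u.2).
  exact: measurable_snd.
have me : measurable_fun setT (fun u : unit * (X * bool) => eta u.2.1).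
  exact: measurableT_comp meta (measurableT_comp measurable_fst m2).
apply: emeasurable_funD; apply: emeasurable_funM.
- by apply/measurable_EFinP; exact: measurable_funB.
- exact: (measurableT_comp (measurable_fun_dirac mA) m2).
- exact/measurable_EFinP.
- apply: (measurableT_comp (measurable_fun_dirac mA)).
  exact: measurableT_comp measurable_flip_label m2.
Qed.

HB.instance Definition _ :=
  isKernel.Build _ _ _ _ R noise_kernel measurable_noise_kernel.

Let noise_kernel_setT u : noise_kernel u [set: X * bool] = 1.
Proof. by rewrite noise_kernelE /noise_step !diracT !mule1 -EFinD subrK. Qed.

HB.instance Definition _ :=
  Kernel_isProbability.Build _ _ _ _ R noise_kernel noise_kernel_setT.

(** [noisy_distr] is the composition of the constant kernel [D] with [noise_kernel], so the integral
    can be iterated. The inner integral, against a weighted sum of two Dirac masses, evaluates [g]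
    at [z] and at [flip_label z]. *)
Lemma ge0_integral_noisy_distr (g : X * bool -> \bar R) :
    (forall z, 0 <= g z) -> measurable_fun [set: X * bool] g ->
  \int[noisy_distr D meta eta01]_z g z =
  \int[D]_z ((1 - eta z.1)%:E * g z + (eta z.1)%:E * g (flip_label z)).
Proof.
move=> g0 mg.
pose l := kprobability (@measurable_cst _ _ unit
  (pprobability (X * bool)%type R) [set: unit] D).
transitivity (\int[kcomp l noise_kernel tt]_z g z).
  apply: eq_measure_integral => A _ _.
  by apply: eq_integral => z _; rewrite (noise_kernelE (tt, z)).
rewrite integral_kcomp//; apply: eq_integral => z _.
rewrite /= ge0_integral_measure_add// !ge0_integral_mscale//=.
by rewrite !integral_dirac// !diracT !mul1e.
Qed.

(** Extends the nonnegative case to signed functions: [h + B] is nonnegative, and because both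
    measures have mass one and the two weights sum to one, the shift adds the same [B] to each
    side. *)
Lemma bounded_integral_noisy_distr (h : X * bool -> R) (B : R) :
    measurable_fun [set: X * bool] h -> (forall z, `|h z| <= B)%R ->
  \int[noisy_distr D meta eta01]_z (h z)%:E =
  \int[D]_z ((1 - eta z.1) * h z + eta z.1 * h (flip_label z))%:E.
Proof.
move=> mh hB.
have hB0 z : (0 <= h z + B)%R.
  by have := hB z; rewrite ler_norml -lerBlDr sub0r => /andP[].
have me : measurable_fun setT (fun z : X * bool => eta z.1).
  exact: measurableT_comp meta measurable_fst.
have mf : measurable_fun setT (h \o @flip_label X).
  exact: measurableT_comp mh measurable_flip_label.
set k := (fun z => ((1 - eta z.1) * h z + eta z.1 * h (flip_label z))%R).
have mk : measurable_fun setT k.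
  apply: measurable_funD; apply: measurable_funM => //.
  exact: measurable_funB.
(* [k z] is a convex combination of two values of [h], so it inherits the bound [B]. *)
have kB z : (`|k z| <= B)%R.
  rewrite (le_trans (ler_normD _ _))// !normrM.
  rewrite (ger0_norm (eta_ge0 _)) (ger0_norm (eta_le1 _)).
  rewrite [leRHS](_ : _ = (1 - eta z.1) * B + eta z.1 * B)%R; last by ring.
  by rewrite lerD// ler_wpM2l.
have int_addB (P : probability (X * bool)%type R) (u : X * bool -> R) :
    measurable_fun setT u -> (forall z, `|u z| <= B)%R ->
    \int[P]_z (u z + B)%:E = \int[P]_z (u z)%:E + B%:E.
  move=> mu uB; under eq_integral do rewrite EFinD.
  rewrite integralD_EFin//; last 2 first.
  - exact: bounded_EFin_integrable uB.
  - exact: finite_measure_integrable_cst.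
  by rewrite integral_cst// [X in _ * X](probability_setT P) mule1.
(* Adding and subtracting the finite [B] on each side reduces the goal to the shifted integrands. *)
rewrite -[LHS](@addeK _ B%:E)// -[RHS](@addeK _ B%:E)//; congr (_ - _).
rewrite -!int_addB// ge0_integral_noisy_distr; last 2 first.
- by move=> z; rewrite lee_fin.
- by apply/measurable_EFinP; exact: measurable_funD.
apply: eq_integral => z _; rewrite -!EFinM -EFinD /k; congr EFin; ring.
Qed.

End noisy_distr_integral.

Section exp_loss.
Context d (X : measurableType d) (R : realType).

Lemma exp_lossN (s : R) (y : bool) : exp_loss s (~~ y) = - exp_loss s y.
Proof. by rewrite /exp_loss; case: y => /=; ring. Qed.

Lemma norm_exp_loss_le (s t : R) (y : bool) :
  `|s| <= t -> `|exp_loss s y| <= expR t.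
Proof.
move=> st; rewrite normrM normrN (ger0_norm (expR_ge0 s)).
rewrite (_ : `|label R y| = 1) ?mul1r; last first.
  by case: y; rewrite /label ?normrN normr1.
by rewrite ler_expR (le_trans (ler_norm s)).
Qed.

Lemma measurable_exp_loss (f : X -> R) : measurable_fun [set: X] f ->
  measurable_fun [set: X * bool] (fun z => exp_loss (f z.1) z.2).
Proof.
move=> mf; apply: measurable_funM.
  apply: measurableT_comp => //.
  exact: (measurableT_comp (f := @label R) _ measurable_snd).
apply: measurableT_comp => //.
exact: measurableT_comp mf measurable_fst.
Qed.

(** Oddness of the loss in the label collapses the two noise branches into one weight. The score
    bound makes the loss bounded by [expR s_max], as the signed integral formula requires. *)
Lemma noisy_risk_exp_loss (D : probability (X * bool)%type R) (eta : X -> R)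
    (meta : measurable_fun [set: X] eta) (eta01 : forall x, 0 <= eta x <= 1)
    (s_max : R) (f : X -> R) :
    measurable_fun [set: X] f -> (forall x, `|f x| <= s_max) ->
  noisy_risk (@exp_loss R) D meta eta01 f =
  (\int[D]_z ((1 - 2 * eta z.1) * exp_loss (f z.1) z.2)%:E)%E.
Proof.
move=> mf fs; rewrite /noisy_risk /risk unlock.
rewrite (@bounded_integral_noisy_distr _ _ _ _ _ _ _ _ (expR s_max)).
- by apply: eq_integral => z _; rewrite exp_lossN; congr EFin; ring.
- exact: measurable_exp_loss.
- by move=> z; exact: norm_exp_loss_le.
Qed.

End exp_loss.

Theorem corollary2 (R : realType) (d : measure_display) (X : measurableType d)
    (D : probability (X * bool)%type R)
    (F : set (X -> R))
    (mF : forall f, F f -> measurable_fun [set: X] f)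
    (eta : X -> R)
    (meta : measurable_fun [set: X] eta)
    (eta01 : forall x, 0 <= eta x <= 1)
    (eta_max s_max : R)
    (eta_le : forall x, eta x <= eta_max)
    (eta_max_lt : eta_max < 1 / 2)
    (F_bounded : forall f, F f -> forall x, `|f x| <= s_max)
    (f_star : X -> R)
    (f_star_min :
       is_minimizer (noisy_risk (@exp_loss R) D meta eta01) F f_star) :
  (risk (@exp_loss R) D f_star
    <= (ereal_inf [set risk (@exp_loss R) D f | f in F]
          + (2 * eta_max * expR s_max)%:E) / (1 - 2 * eta_max)%:E)%E.
Proof.
case: f_star_min => Ff_star min_f_star.
set m := 1 - 2 * eta_max; set B := expR s_max.
have m0 : 0 < m by rewrite /m; lra.
(* Positivity of [m] rules out inverting zero and allows clearing the denominator. With the finite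
   constant moved to the left, the goal bounds an infimum from below, hence is checked against one
   competitor [f] at a time. *)
rewrite inver gt_eqF// lee_pdivlMr// -leeBlDr//.
apply/ereal_infP => _ [f Ff <-].
rewrite leeBlDr//.
have mL g : F g -> measurable_fun setT (fun z => exp_loss (g z.1) z.2).
  by move=> Fg; exact: measurable_exp_loss (mF _ Fg).
have L_le g : F g -> forall z, `|exp_loss (g z.1) z.2| <= B.
  by move=> Fg z; exact: norm_exp_loss_le (F_bounded _ Fg _).
have L_int g : F g ->
    D.-integrable setT (EFin \o (fun z => exp_loss (g z.1) z.2)).
  by move=> Fg; exact: bounded_EFin_integrable (mL _ Fg) (L_le _ Fg).
have wL_int g : F g -> D.-integrable setT
    (EFin \o (fun z => (1 - 2 * eta z.1) * exp_loss (g z.1) z.2)).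
  move=> Fg; apply: (bounded_EFin_integrable _ _ _ _ _ B).
    apply: measurable_funM; last exact: mL.
    apply: measurable_funB => //; apply: measurable_funM => //.
    exact: measurableT_comp meta measurable_fst.
  move=> z; rewrite normrM (le_trans _ (L_le _ Fg z))// ler_piMl//.
  have /andP[eta0 eta1] := eta01 z.1.
  by rewrite ler_norml; apply/andP; split; lra.
have := min_f_star _ Ff.
rewrite !(noisy_risk_exp_loss _ _ _ _ _ _ _ s_max); try exact: mF;
  try exact: F_bounded.
set c := (\int[D]_z _)%E; set e := (\int[D]_z _)%E => ce.
have e_fin : e \is a fin_num by exact: integrable_fin_num (wL_int _ Ff).
(* [c] and [e] are the noisy risks of [f_star] and [f]. Adding the finite [e] to both sides lets
   minimality, [ce], replace it by [c] on the right; what remains involves only integrals over [D]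
   and will hold pointwise. *)
rewrite -(leeD2rE _ _ e_fin).
have kB_int := finite_measure_integrable_cst D (2 * eta_max * B) measurableT.
have kBE : (2 * eta_max * B)%:E = (\int[D]_z (2 * eta_max * B)%:E)%E.
  by rewrite integral_cst// [X in (_ * X)%E](probability_setT D) mule1.
suff : (risk (@exp_loss R) D f_star * m%:E + e
    <= risk (@exp_loss R) D f + (2 * eta_max * B)%:E + c)%E.
  by move=> /le_trans; apply; rewrite leeD2l.
rewrite kBE /risk unlock -integralZr//; last exact: L_int.
have mL_int := integrableZr measurableT m (L_int _ Ff_star).
rewrite -integralD//; last exact: wL_int.
rewrite -integralD//; last exact: L_int.
rewrite -integralD//; [|exact: integrableD (L_int _ Ff) kB_int|exact: wL_int].
apply: le_integral => //.
- by apply: integrableD => //; exact: wL_int.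
- apply: integrableD => //; last exact: wL_int.
  by apply: integrableD => //; exact: L_int.
move=> z _.
rewrite -EFinM -!EFinD lee_fin.
have /andP[eta0 _] := eta01 z.1.
have /andP[lf _] : (- B <= exp_loss (f z.1) z.2 <= B).
  by rewrite -ler_norml L_le.
have /andP[lg _] : (- B <= exp_loss (f_star z.1) z.2 <= B).
  by rewrite -ler_norml L_le.
(* The right side of the pointwise inequality exceeds the left by exactly twice the sum of the
   quantities in [hf] and [hg]. *)
have hf : 0 <= eta z.1 * (exp_loss (f z.1) z.2 + B).
  by rewrite mulr_ge0// -lerBlDr sub0r.
have hg : 0 <= (eta_max - eta z.1) * (exp_loss (f_star z.1) z.2 + B).
  by rewrite mulr_ge0 ?subr_ge0// -lerBlDr sub0r.
rewrite /m; lra.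
Qed.
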